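(* Let $r$, $d$ and $n$ be positive integers. If $r\ge 2$ and $n\ge 2r$, then there exists a self-centered radially maximal graph of radius $r$ and order $n$. If $r<d\le 2r-2$ and $n\ge 3r-1$, then there exists a radially maximal graph of radius $r$, diameter $d$ and order $n$.
   Context: All graphs are finite and simple. For a connected graph $G$, the eccentricity $e(v)$ of a vertex $v$ is the maximum distance from $v$ to any vertex; the radius ${\rm rad}(G)$ is the minimum eccentricity and the diameter ${\rm diam}(G)$ is the maximum eccentricity. A graph is self-centered if its radius equals its diameter. A graph $G$ is radially maximal if it is not complete and ${\rm rad}(G+e)<{\rm rad}(G)$ for every edge $e$ of the complement of $G$ (i.e., adding any new edge decreases the radius). The order of a graph is its number of vertices. *)

(* Defs.v *)
From mathcomp Require Import all_boot.

Set Implicit Arguments.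
Unset Strict Implicit.
Unset Printing Implicit Defensive.

Record sgraph := SGraph {
  vertex : finType;
  adj : rel vertex;
  adj_sym : symmetric adj;
  adj_irrefl : irreflexive adj
}.

Section Graphs.
Variable G : sgraph.
Implicit Types x y u v : vertex G.

Definition graph_order : nat := #|vertex G|.

(* The graph with no vertices is not considered connected. *)
Definition connected : bool :=
  (0 < graph_order) && [forall x, forall y, connect (@adj G) x y].

Definition complete : bool :=
  [forall x, forall y, (x != y) ==> @adj G x y].

Definition walk_of_length x y (k : nat) : bool :=
  [exists p : k.-tuple (vertex G), path (@adj G) x p && (last x p == y)].

(* Distances between vertices in the same component are < graph_order; the value
   is graph_order when y is not reachable from x. *)
Definition dist x y : nat := find (walk_of_length x y) (iota 0 graph_order).

Definition ecc v : nat := \max_(u : vertex G) dist v u.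

(* The default value graph_order of the minimum exceeds every eccentricity of a
   connected graph (see rad_attained). *)
Definition rad : nat := \big[minn/graph_order]_(v : vertex G) ecc v.

Definition diam : nat := \max_(v : vertex G) ecc v.

Definition self_centered : bool := connected && (rad == diam).

Definition add_edge_rel x y : rel (vertex G) := fun u v =>
  @adj G u v || (u != v) && ((u == x) && (v == y) || (u == y) && (v == x)).

Lemma add_edge_sym x y : symmetric (add_edge_rel x y).
Proof.
move=> u v; rewrite /add_edge_rel adj_sym (eq_sym u v); congr (_ || (_ && _)).
by rewrite orbC [(u == y) && _]andbC [(u == x) && _]andbC.
Qed.

Lemma add_edge_irrefl x y : irreflexive (add_edge_rel x y).
Proof. by move=> u; rewrite /add_edge_rel adj_irrefl eqxx. Qed.

Definition add_edge x y : sgraph :=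
  SGraph (add_edge_sym x y) (add_edge_irrefl x y).

End Graphs.

Definition radially_maximal (G : sgraph) : Prop :=
  [/\ connected G, ~~ complete G &
      forall x y : vertex G,
        x != y -> ~~ adj x y -> rad (add_edge x y) < rad G].

Section Facts.
Variable G : sgraph.
Implicit Types x y v : vertex G.

Lemma walk_path x p : path (@adj G) x p -> walk_of_length x (last x p) (size p).
Proof. by move=> xp; apply/existsP; exists (in_tuple p); rewrite /= xp eqxx. Qed.

Lemma dist_le x p : path (@adj G) x p -> dist x (last x p) <= size p.
Proof.
move=> /walk_path w; have [lt|ge] := ltnP (size p) (graph_order G); last first.
  by apply: leq_trans ge; rewrite -[leqRHS](size_iota 0) find_size.
rewrite leqNgt; apply/negP => /(before_find 0).
by rewrite nth_iota // add0n w.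
Qed.

Lemma dist_lt x y : connect (@adj G) x y -> dist x y < graph_order G.
Proof.
case/connectP => p xp ->; case/shortenP: xp => q xq uq _.
apply: leq_ltn_trans (dist_le xq) _.
by have := max_card [in x :: q]; rewrite (card_uniqP uq).
Qed.

Lemma dist_attained x y : connect (@adj G) x y ->
  exists p, [/\ path (@adj G) x p, last x p = y & size p = dist x y].
Proof.
move=> /dist_lt lt; have: has (walk_of_length x y) (iota 0 (graph_order G)).
  by rewrite has_find size_iota.
move=> /(nth_find 0); rewrite nth_iota // add0n => /existsP[p /andP[xp /eqP e]].
by exists p; split=> //; rewrite size_tuple.
Qed.

Lemma rad_le v : rad G <= ecc v.
Proof.
rewrite /rad; have := mem_index_enum v.
elim: (index_enum _) => //= u s IH; rewrite inE big_cons geq_min.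
by case/predU1P => [<-|/IH ->]; rewrite ?leqnn ?orbT.
Qed.

Lemma rad_attained : connected G -> exists v, rad G = ecc v.
Proof.
case/andP => /card_gt0P[v0 _] /forallP conn.
have ltv v : ecc v < graph_order G.
  have o_gt0 : 0 < graph_order G by apply/card_gt0P; exists v.
  rewrite -(prednK o_gt0) ltnS; apply/bigmax_leqP => u _.
  by rewrite -ltnS prednK // dist_lt //; have /forallP := conn v.
have [v _ vP] := arg_minnP (@ecc G) (erefl : xpredT v0).
exists v; apply/eqP; rewrite eqn_leq rad_le /= /rad.
elim/big_rec: _ => [|u m _ le]; first exact: ltnW.
by rewrite leq_min vP.
Qed.

End Facts.

(* Main.v *)
(** A connected graph of radius r >= 2 becomes radially maximal, with the same
    radius, once edges have been added greedily as long as the radius stays r.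
    So it suffices to find a graph G of radius r and order n all of whose
    spanning supergraphs of radius r have the prescribed diameter.

    Self-centered case: G is the cycle of length 2r with one vertex blown up to
    a clique.  Its diameter is r, so a supergraph of radius r has diameter r.

    Case d = r + t with 0 < t < r - 1: G is the odd cycle 0, ..., 2r-2 together
    with a path (the tail) of t further vertices attached at the vertex t, and
    pendant vertices attached at 2t+1, 2t+3, ..., 2r-3 and at 2r-2, the last two
    of which are joined; vertex 0 is blown up to a clique to reach order n.  The
    tip of the tail and the pendant vertex opposite to t are at distance r + t.
    A cycle vertex c at distance at most r - 1 - t from t has eccentricity r
    only because of the pendant vertices at its antipodes c + r - 1 and c + r,
    while the antipodes of any other cycle vertex lie in 0, ..., 2t, so that
    only the tail is far from it.  An edge added to G that skips a level of the
    distance from the tip is the shortcut that lowers the eccentricity of some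
    such c to r - 1.  Hence a supergraph of radius r has no such edge, and the
    distance r + t survives. *)

Require Import Defs.
From mathcomp Require Import all_boot.
From mathcomp Require Import zify.

Set Implicit Arguments.
Unset Strict Implicit.
Unset Printing Implicit Defensive.

(** * Walks and distances *)

Definition reach (T : eqType) (e : rel T) (k : nat) (x y : T) : Prop :=
  exists p, [/\ path e x p, last x p = y & size p <= k].

Section Reach.
Variables (T : eqType) (e : rel T).
Implicit Types (x y z : T) (k l : nat).

Lemma reach_refl x : reach e 0 x x.
Proof. by exists [::]. Qed.

Lemma reach0 x y : reach e 0 x y -> x = y.
Proof. by case=> [[|? ?] [_ /=]]. Qed.

Lemma reach_edge x y : e x y -> reach e 1 x y.
Proof. by move=> xy; exists [:: y]; rewrite /= xy. Qed.

Lemma reach_trans k l x y z :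
  reach e k x y -> reach e l y z -> reach e (k + l) x z.
Proof.
move=> [p [xp <- pk]] [q [yq <- ql]]; exists (p ++ q).
by rewrite cat_path xp yq last_cat size_cat leq_add.
Qed.

Lemma reach_weaken k l x y : k <= l -> reach e k x y -> reach e l x y.
Proof. by move=> kl [p [xp lp pk]]; exists p; rewrite xp (leq_trans pk). Qed.

Lemma reach_sub (e' : rel T) k x y :
  subrel e e' -> reach e k x y -> reach e' k x y.
Proof. by move=> ee' [p [/(sub_path ee') xp lp pk]]; exists p. Qed.

Lemma reach_sym k x y : symmetric e -> reach e k x y -> reach e k y x.
Proof.
move=> es [p [xp lp pk]]; exists (rev (belast x p)).
rewrite -{1 2}lp rev_path (eq_path (e' := e)) => [|u v]; last exact: es.
rewrite xp size_rev size_belast pk; split=> //.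
by case: p {xp pk} lp => //= a p _; rewrite rev_cons last_rcons.
Qed.

End Reach.

(** * Bounds on distances, eccentricities, radius and diameter *)

Section Distances.
Variable G : sgraph.
Implicit Types (x y c : vertex G) (k : nat).

Lemma dist_le_reach k x y : reach (@adj G) k x y -> dist x y <= k.
Proof. by move=> [p [/dist_le xp <- pk]]; apply: leq_trans pk. Qed.

Lemma connected_connect x y : connected G -> connect (@adj G) x y.
Proof. by case/andP=> _ /forallP/(_ x)/forallP/(_ y). Qed.

Lemma connected_reach x0 :
  (forall x y, exists k, reach (@adj G) k x y) -> connected G.
Proof.
move=> h; apply/andP; split; first by apply/card_gt0P; exists x0.
apply/forallP=> x; apply/forallP=> y; apply/connectP.
by have [k [p [xp lp _]]] := h x y; exists p.
Qed.

Lemma reach_dist x y : connected G -> reach (@adj G) (dist x y) x y.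
Proof.
move=> /(connected_connect x y)/dist_attained[p [xp lp sp]].
by exists p; rewrite sp.
Qed.

Lemma dist_sym x y : connected G -> dist x y = dist y x.
Proof.
have le (a b : vertex G) : connected G -> dist a b <= dist b a.
  move=> conn; apply: dist_le_reach; apply: (reach_sym (@adj_sym G)).
  exact: reach_dist.
by move=> conn; apply/eqP; rewrite eqn_leq !le.
Qed.

(** The source of all lower bounds on distances: a potential that grows by at most one along each
    edge. *)
Lemma lipschitz_dist (f : vertex G -> nat) x y : connected G ->
  (forall u v, adj u v -> f v <= (f u).+1) -> f y <= f x + dist x y.
Proof.
move=> conn lip; have [p [xp <- pk]] := reach_dist x y conn.
apply: leq_trans (_ : f (last x p) <= f x + size p) _; last first.
  by rewrite leq_add2l.
elim: p x xp {pk} => [|z p IH] x /=; first by rewrite addn0.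
case/andP=> /lip xz /IH IHz; apply: leq_trans IHz _.
  rewrite addnS -addSn leq_add2r.
  exact: xz.
Qed.

Lemma ecc_leP c k : reflect (forall x, dist c x <= k) (ecc c <= k).
Proof. by apply: (iffP (bigmax_leqP _ _ _)) => h x => [|_]; apply: h. Qed.

Lemma dist_ecc c x : dist c x <= ecc c.
Proof. exact/ecc_leP. Qed.

Lemma diam_leP k : reflect (forall x y, dist x y <= k) (diam G <= k).
Proof.
apply: (iffP (bigmax_leqP _ _ _)) => [h x|h x _]; last exact/ecc_leP.
exact/ecc_leP/h.
Qed.

Lemma dist_diam x y : dist x y <= diam G.
Proof. exact/diam_leP. Qed.

Lemma rad_geP k : connected G ->
  (forall c, exists x, k <= dist c x) -> k <= rad G.
Proof.
move=> /rad_attained[c ->] /(_ c)[x] /leq_trans; apply; exact: dist_ecc.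
Qed.

Lemma rad_le_reach k c : (forall x, reach (@adj G) k c x) -> rad G <= k.
Proof.
move=> h; apply: leq_trans (rad_le c) _.
by apply/ecc_leP=> x; apply/dist_le_reach.
Qed.

End Distances.

(** * Spanning supergraphs and greedy addition of edges *)

Section Supergraph.
Variables (T : finType) (e f : rel T).
Hypotheses (es : symmetric e) (ei : irreflexive e).
Hypotheses (fs : symmetric f) (fi : irreflexive f).
Hypothesis ef : subrel e f.
Let G := SGraph es ei.
Let H := SGraph fs fi.
Hypothesis connG : connected G.

Lemma connected_supergraph : connected H.
Proof.
have /andP[/card_gt0P[x0 _] _] := connG.
apply: (@connected_reach H x0) => x y; exists (@dist G x y).
exact: reach_sub ef (@reach_dist G x y connG).
Qed.

Lemma dist_supergraph x y : @dist H x y <= @dist G x y.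
Proof. exact/dist_le_reach/(reach_sub ef)/(@reach_dist G). Qed.

Lemma diam_supergraph : diam H <= diam G.
Proof.
by apply/diam_leP=> x y; apply: leq_trans (dist_supergraph x y) (dist_diam _ _).
Qed.

Lemma rad_supergraph : rad H <= rad G.
Proof.
have [c ->] := rad_attained connG; apply: leq_trans (@rad_le H c) _.
by apply/ecc_leP=> x; apply: leq_trans (dist_supergraph c x) (dist_ecc _ _).
Qed.

End Supergraph.

Lemma radially_maximal_supergraph (T : finType) (e : rel T)
    (es : symmetric e) (ei : irreflexive e) r :
  1 < r -> connected (SGraph es ei) -> rad (SGraph es ei) = r ->
  exists (f : rel T) (fs : symmetric f) (fi : irreflexive f),
    [/\ subrel e f, radially_maximal (SGraph fs fi) & rad (SGraph fs fi) = r].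
Proof.
(* Induction on a bound for the number of non-adjacent ordered pairs, which drops with every added
   edge. *)
move=> r_gt1; move: {2}_.+1 (ltnSn #|[pred p : T * T | ~~ e p.1 p.2]|) => m.
elim: m e es ei => // m IH e es ei lem conn radG.
case: (pickP [pred p : T * T | [&& p.1 != p.2, ~~ e p.1 p.2 &
    r <= rad (@add_edge (SGraph es ei) p.1 p.2)]]) => [[x y] /=|none].
  case/and3P=> xy nexy rad_ge.
  have sub : subrel e (@add_edge_rel (SGraph es ei) x y).
    by move=> u v uv; rewrite /add_edge_rel /= uv.
  have conn' := connected_supergraph (@add_edge_sym (SGraph es ei) x y)
    (@add_edge_irrefl (SGraph es ei) x y) sub conn.
  have rad' : rad (@add_edge (SGraph es ei) x y) = r.
    by apply/eqP; rewrite eqn_leq rad_ge andbT -radG; apply: rad_supergraph.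
  have [|f [fs [fi [ef fmax frad]]]] := IH _ _ _ _ conn' rad'.
    rewrite -ltnS; apply: leq_trans lem; rewrite ltnS.
    apply/proper_card/properP.
    split; first by apply/subsetP=> p; rewrite !inE; apply/contra/sub.
    exists (x, y); rewrite !inE //= negbK /add_edge_rel /=.
    by rewrite xy !eqxx orbT.
  exists f, fs, fi; split=> // u v /sub; exact: ef.
exists e, es, ei; split=> //; split=> //.
- apply/negP=> /forallP compl; have [c rc] := rad_attained conn.
  suff: @ecc (SGraph es ei) c <= 1 by lia.
  apply/ecc_leP=> x; have [->|cx] := eqVneq c x.
    exact/(leq_trans _ (leqnSn 0))/dist_le_reach/reach_refl.
  by apply/dist_le_reach/reach_edge; move/forallP/(_ x): (compl c); rewrite cx.
- move=> x y xy nxy; move: (none (x, y)) => /=.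
  by rewrite xy nxy /= radG ltnNge => ->.
Qed.

(** * The blown-up even cycle *)

Definition cyc_adj (N p q : nat) : bool :=
  [|| q == p.+1, p == q.+1, (p == 0) && (q.+1 == N) | (q == 0) && (p.+1 == N)].

(** Subtraction is truncated, so [p - q + (q - p)] is |p - q|; the minimum selects the shorter
    arc. *)
Definition cyc_dist (N p q : nat) : nat :=
  minn (p - q + (q - p)) (N - (p - q + (q - p))).

Lemma cyc_adjC N : symmetric (cyc_adj N).
Proof. by move=> p q; rewrite /cyc_adj; lia. Qed.

Lemma cyc_dist_adj N w p q : w < N -> p < N -> q < N -> cyc_adj N p q ->
  cyc_dist N w q <= (cyc_dist N w p).+1.
Proof. by rewrite /cyc_adj /cyc_dist; lia. Qed.

(** * Walks around a cycle with blown-up positions, for both constructions *)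

Section BlownUpCycle.
Variables (T : finType) (e : rel T) (C : pred T) (pos : T -> nat) (N : nat).
Hypothesis N_gt1 : 1 < N.
Hypothesis pos_lt : forall v, C v -> pos v < N.
Hypothesis pos_onto : forall p, p < N -> exists2 v, C v & pos v = p.
Hypothesis C_edge : forall u v, C u -> C v -> u != v ->
  (pos u == pos v) || cyc_adj N (pos u) (pos v) -> e u v.

Lemma reach_cyc_forward k u v : C u -> C v -> k.+1 < N ->
  (pos v = pos u + k.+1) \/ (pos v + N = pos u + k.+1) -> reach e k.+1 u v.
Proof.
elim: k v => [|k IH] v Cu Cv kN uv; have := pos_lt Cu; have := pos_lt Cv.
  move=> vN uN; apply/reach_edge/C_edge => //; last by rewrite /cyc_adj; lia.
  by apply/eqP=> E; move: uv; rewrite E; lia.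
move=> vN uN; pose p := pos u + k.+1.
have [w Cw pw] : exists2 w, C w & pos w = if p < N then p else p - N.
  by apply: pos_onto; rewrite /p; case: ifP; lia.
have uw : reach e k.+1 u w.
  by apply: IH => //; first lia; rewrite pw /p; case: ifP; lia.
rewrite -addn1; apply: reach_trans uw _; apply/reach_edge/C_edge => //.
  by apply/eqP=> E; move: uv pw; rewrite E /p; case: ifP; lia.
by rewrite pw /p /cyc_adj; case: ifP; lia.
Qed.

Hypothesis es : symmetric e.

(** The bound [0 < k] accounts for distinct copies of one position: their cyclic distance is 0, but
    they are one edge apart. *)
Lemma reach_cyc k u v : C u -> C v -> 0 < k ->
  cyc_dist N (pos u) (pos v) <= k -> reach e k u v.
Proof.
move=> Cu Cv k_gt0 uvk; have := pos_lt Cu; have := pos_lt Cv => vN uN.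
have [->|uv] := eqVneq u v; first exact: reach_weaken (reach_refl e v).
have [Epos|Npos] := eqVneq (pos u) (pos v).
  by apply: reach_weaken k_gt0 _; apply/reach_edge/C_edge; rewrite ?Epos ?eqxx.
pose d := cyc_dist N (pos u) (pos v).
have [m Em] : exists m, d = m.+1.
  by exists d.-1; rewrite /d /cyc_dist; lia.
apply: (reach_weaken uvk); rewrite -/d Em.
have mN : m.+1 < N by rewrite -Em /d /cyc_dist; lia.
case: (boolP ((pos v == pos u + m.+1) || (pos v + N == pos u + m.+1))) => fwd.
  by apply: reach_cyc_forward => //; lia.
apply: reach_sym => //; apply: reach_cyc_forward => //.
by move: Em fwd; rewrite /d /cyc_dist; lia.
Qed.

End BlownUpCycle.

(** * The self-centered graph *)

Section EvenCycle.
Variables r n : nat.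
Hypotheses (r_gt1 : 1 < r) (le_2r_n : 2 * r <= n).

Definition even_pos (i : 'I_n) : nat := if i < 2 * r then i : nat else 0.

Definition even_rel : rel 'I_n := fun u v =>
  (u != v) && ((even_pos u == even_pos v) ||
               cyc_adj (2 * r) (even_pos u) (even_pos v)).

Lemma even_rel_sym : symmetric even_rel.
Proof.
by move=> u v; rewrite /even_rel eq_sym cyc_adjC [even_pos u == _]eq_sym.
Qed.

Lemma even_rel_irrefl : irreflexive even_rel.
Proof. by move=> u; rewrite /even_rel eqxx. Qed.

Let G := SGraph even_rel_sym even_rel_irrefl.

Lemma even_pos_lt u : even_pos u < 2 * r.
Proof. by rewrite /even_pos; case: ifP; lia. Qed.

Lemma even_pos_onto p : p < 2 * r -> exists u, even_pos u = p.
Proof.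
move=> lt_p; have lt_n : p < n by lia.
by exists (Ordinal lt_n); rewrite /even_pos /= lt_p.
Qed.

Lemma even_reach u v : reach even_rel r u v.
Proof.
apply: (@reach_cyc _ _ predT even_pos (2 * r)) => //; first lia.
- by move=> ? _; apply: even_pos_lt.
- by move=> p /even_pos_onto[w]; exists w.
- by move=> x y _ _ xy h; rewrite /even_rel xy.
- exact: even_rel_sym.
- by lia.
- by have := even_pos_lt u; have := even_pos_lt v; rewrite /cyc_dist; lia.
Qed.

Lemma even_connected : connected G.
Proof.
have [x _] := @even_pos_onto 0 ltac:(lia).
by apply: (@connected_reach G x) => u v; exists r; apply: even_reach.
Qed.

Lemma even_rad_ge : r <= rad G.
Proof.
apply: rad_geP even_connected _ => c; have c_lt := even_pos_lt c.
have [x px] : exists x, even_pos x =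
    if even_pos c < r then even_pos c + r else even_pos c - r.
  by apply: even_pos_onto; case: ifP; lia.
exists x; pose f v := cyc_dist (2 * r) (even_pos c) (even_pos v).
have lip u v : @adj G u v -> f v <= (f u).+1.
  case/andP=> _ /orP[/eqP E|]; first by rewrite /f E; lia.
  by apply: cyc_dist_adj; apply: even_pos_lt.
have := lipschitz_dist c x even_connected lip.
by rewrite /f px /cyc_dist; case: ifP; lia.
Qed.

Lemma exists_self_centered_radially_maximal : exists H : sgraph,
  [/\ self_centered H, radially_maximal H, rad H = r & graph_order H = n].
Proof.
have radG : rad G = r.
  apply/eqP; rewrite eqn_leq even_rad_ge andbT.
  have [x _] := @even_pos_onto 0 ltac:(lia).
  by apply: (@rad_le_reach G r x) => v; apply: even_reach.
have [f [fs [fi [ef fmax frad]]]] :=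
  radially_maximal_supergraph r_gt1 even_connected radG.
exists (SGraph fs fi); split=> //; last exact: card_ord.
have [fconn _ _] := fmax; rewrite /self_centered fconn frad /=.
rewrite eqn_leq; apply/andP; split.

  have [c Ec] := rad_attained fconn; rewrite -frad Ec.
  by apply/ecc_leP=> x; apply: dist_diam.
apply/diam_leP=> x y; apply/dist_le_reach/(reach_sub ef)/even_reach.
Qed.

End EvenCycle.

(** * The odd cycle with a tail *)

Section TailedCycle.
Variables r t N : nat.
Hypotheses (t_gt0 : 0 < t) (t_lt : t + 2 <= r) (NE : N + 1 = 2 * r).

(* A vertex has coordinates (p, h): its nearest cycle vertex p < N and its
   distance h to the cycle.  [branch_spec] lists the coordinates with h > 0. *)
Variant branch_spec (p h : nat) : Prop :=
  | BranchTail of p = t & 0 < h <= t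
  | BranchOdd j of p = 2 * j + 1 & 2 * t + 1 <= p & p + 3 <= 2 * r & h = 1
  | BranchLast of p + 2 = 2 * r & h = 1.

(* The distance between the vertices (p, h) and (q, l) is at most k: along either
   arc of the cycle, inside the tail, or through the edge joining two pendant
   vertices.  Both sides of the inequalities are moved to avoid subtraction. *)
Definition tc_close (k p h q l : nat) : Prop :=
  (p + h + l <= q + k /\ q + h + l <= p + k) \/
  (N + p + h + l <= q + k \/ N + q + h + l <= p + k) \/
  (p = q /\ h <= l + k /\ l <= h + k) \/
  (h = 1 /\ l = 1 /\ p + q + 5 = 4 * r /\ 2 * r <= p + 3 /\ p + 2 <= 2 * r /\
   0 < k).

(* Some cycle vertex c reaches every other vertex in at most r - 1 steps once an
   edge from (p, h) to (q, l) is added; cycle vertices need no shortcut. *)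
Definition tc_good (p h q l : nat) : Prop :=
  exists c k k', [/\ c < N, k + k' + 2 = r, tc_close k c 0 p h &
    forall q' l', branch_spec q' l' ->
      tc_close (k + k' + 1) c 0 q' l' \/ tc_close k' q l q' l'].

Lemma tc_goodI p h q l c k k' : c < N -> k + k' + 2 = r -> tc_close k c 0 p h ->
  (forall q' l', branch_spec q' l' ->
    tc_close (k + k' + 1) c 0 q' l' \/ tc_close k' q l q' l') ->
  tc_good p h q l.
Proof. by exists c, k, k'. Qed.

(* The first alternative fails only if q is one of the two antipodes of c. *)
Lemma tc_antipodal k c q : k + 1 = r -> c < N -> q < N ->
  tc_close k c 0 q 1 \/
  (q + 1 = c + r \/ q = c + r \/ c + 1 = q + r \/ c = q + r).
Proof. by rewrite /tc_close; lia. Qed.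

(** * Shortcuts that bring some cycle vertex within r - 1 of every vertex *)

Ltac close :=
  rewrite /tc_close;
  first [ left; lia | right; left; left; lia | right; left; right; lia
        | right; right; left; lia | right; right; right; lia ].

Ltac pendant c :=
  match goal with
  | |- tc_close ?k _ _ ?q _ \/ _ =>
    case: (@tc_antipodal k c q ltac:(lia) ltac:(lia) ltac:(lia));
    [ by left
    | case=> [?|[?|[?|?]]]; first [ exfalso; lia | right; close ] ]
  end.

(** Proposes the centre [c], with [k] steps before the new edge and [k'] after it. The tip of the
    tail is separated from the rest of the tail, and a pendant vertex is a problem only at an
    antipode of [c]. *)
Ltac center c k k' :=
  apply: (@tc_goodI _ _ _ _ c k k');
  [ lia | lia | close
  | let q := fresh "q" in let l := fresh "l" in let h := fresh in
    move=> q l [? ?|? ? ? ? ->|? ->];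
    [ have [h|h] : l = t \/ l < t by lia
    | pendant c | pendant c];
    first [left; close | right; close] ].

(** The antipodes of the centre r are 0 and 1, which carry no pendant, so only the tail has to come
    closer. *)
Lemma tc_good_tail_tail h l : 0 < h -> h + 2 <= l <= t -> tc_good t h t l.
Proof. by move=> h_gt0 hl; center r (r - t + h) (t - h - 2). Qed.

(** The vertices whose antipodes lie in 0, ..., 2t form an arc from r to 2t + r - 1 modulo N, whose
    ends are at distance r - t from t. The centre is [q] if [q] lies on this arc, and otherwise the
    end on the side of [q]. *)
Lemma tc_good_cycle_tail h q : 0 < h <= t -> q < N -> (q != t) || (1 < h) ->
  tc_good q 0 t h.
Proof.
move=> h_t q_lt neq.
have [q_r|[q_far|[q_l|q_l]]] : (t <= q <= r) \/
    (((r < q < 2 * t + r) || (q + r <= 2 * t)) \/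
     ((2 * t + r <= q) \/ (q < t) && (2 * t < q + r))) by lia.
- by center r (r - q) (q - 2).
- by center q 0 (r - 2).
- by center (2 * t + r - 1) (q + 1 - (2 * t + r)) (2 * t + 2 * r - 3 - q).
(* Reduced modulo N, the end 2t + r - 1 of the arc becomes 2t - r once r <= 2t. *)
have [t_r|t_r] := leqP r (2 * t).
  by center (2 * t - r) (q + r - 2 * t) (2 * t - q - 2).
by center (2 * t + r - 1) (q + r - 2 * t) (2 * t - q - 2).
Qed.

Lemma tc_good_pendant_tail h q :
  0 < h <= t -> branch_spec q 1 -> q != t -> tc_good q 1 t h.
Proof.
move=> h_t br neq; have q_r : 2 * t + 1 <= q <= 2 * r - 2 by case: br; lia.
clear br; have [q_l|[q_m|q_h]] : (q < r) \/ ((r <= q < 2 * t + r) \/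
  (2 * t + r <= q)) by lia.
- by center r (r - q + 1) (q - 3).
- by center q 1 (r - 3).
- by center (2 * t + r - 1) (q + 2 - (2 * t + r)) (2 * t + 2 * r - 4 - q).
Qed.

Lemma tc_side x : x < N -> exists a, [/\ cyc_dist N t x = a, a < r &
  x = t + a \/ (x + a = t \/ x + a = t + N)].
Proof.
by move=> x_lt; exists (cyc_dist N t x); rewrite /cyc_dist; split; lia.
Qed.

(** Let a and b be the distances of p and q from t. If b <= r - t, the centre is at distance r - t
    from t on the side of q; if b > r - t and a <= r - t - 2, it is q. In both cases the tail comes
    closer. Otherwise the centre is at distance r - 1 - t from t on the side of p, and the edge
    shortens the way to its only pendant antipode, at 2r - 2 or 2t + 1. *)
Lemma tc_good_cycle_cycle p q : p < N -> q < N ->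
  cyc_dist N t p + 2 <= cyc_dist N t q -> tc_good p 0 q 0 \/ tc_good q 0 p 0.
Proof.
move=> p_lt q_lt; have [a [-> a_lt side_p]] := tc_side p_lt.
have [b [-> b_lt side_q]] := tc_side q_lt => ab.
have [[b_s|[b_l a_s]]|[b_l a_l]] :
  (b + t <= r \/ r < b + t /\ a + t + 2 <= r) \/
  (r < b + t /\ r < a + t + 2) by lia.
- right; case: side_q => q_r.
    by case: side_p => [p_r|[p_l|p_l]]; center r (r - t - b) (t + b - 2).
  have [t_r|t_r] := leqP r (2 * t);
    case: side_p => [p_r|[p_l|p_l]]; case: q_r => q_l;
    first [ center (2 * t - r) (r - t - b) (t + b - 2)
          | center (2 * t + r - 1) (r - t - b) (t + b - 2) ].
- right; case: side_p => [p_r|[p_l|p_l]]; case: side_q => [q_r|[q_l|q_l]];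
    center q 0 (r - 2).
- left; case: side_p => [p_r|p_l].
    by case: side_q => [q_r|[q_l|q_l]];
      center (r - 1) (a + t + 1 - r) (2 * r - 3 - a - t).
  have [t_r|t_r] := leqP r (2 * t + 1);
    case: p_l => p_l; case: side_q => [q_r|[q_l|q_l]];
    first [ center (2 * t + 1 - r) (a + t + 1 - r) (2 * r - 3 - a - t)
          | center (2 * t + r) (a + t + 1 - r) (2 * r - 3 - a - t) ].
Qed.

Lemma tc_good_pendant_cycle p q : branch_spec p 1 -> p != t -> q < N ->
  p != q -> tc_good p 1 q 0 \/ tc_good q 0 p 1.
Proof.
move=> br p_t q_lt pq.
have p_r : 2 * t + 1 <= p <= 2 * r - 2 by case: br; lia.
have par : (exists j, p = 2 * j + 1) \/ p + 2 = 2 * r.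
  by case: br => [|j|]; [lia|left; exists j|right].
clear br; right.
(* The antipodes of r - 2 are 2r - 3 and 2r - 2, the only consecutive positions that both carry
   pendants; the edge joining these pendants serves the second one. *)
have [[p_l q_l]|n1] : (2 * r <= p + 3 /\ q + 2 = r) \/
   ~ (2 * r <= p + 3 /\ q + 2 = r) by lia.
  have [p_l'|p_l'] : p + 3 = 2 * r \/ p + 2 = 2 * r by lia.
    by center q 0 (r - 2).
  by center q 0 (r - 2).
(* Here and in the next case the centre has a single pendant antipode, the partner of [p], reached
   through the new edge and then the edge joining the two pendants. *)
have [[p_l q_l]|n2] : (p + 3 = 2 * r /\ r <= q + 1 <= p) \/
   ~ (p + 3 = 2 * r /\ r <= q + 1 <= p) by lia.
  by center (r - 1) (q + 1 - r) (2 * r - 3 - q).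
have [[p_l q_l]|n3] : (p + 2 = 2 * r /\ q + 3 <= r) \/
   ~ (p + 2 = 2 * r /\ q + 3 <= r) by lia.
  by center (r - 3) (r - 3 - q) (q + 1).
(* From here on the centre is the antipode of [p] whose shortest route to [p] passes through [q].
   Its other antipode carries no pendant, since pendant positions except 2r - 2 are odd. *)
have [q_p|p_q] := ltnP q p.
  have [near|far] := leqP p (q + r - 1).
    have p_n : p + 3 != 2 * r by lia.
    clear n1 n2 n3; have [p_s|p_s] := leqP r (p + 1).
      by case: par => [[j Ej]|Ej];
        center (p + 1 - r) (q + r - p - 1) (p - q - 1).
    by case: par => [[j Ej]|Ej]; center (p + r) (q + r - p - 1) (p - q - 1).
  have p_n : p + 2 != 2 * r by lia.
  clear n1 n2 n3; case: par => [[j Ej]|Ej]; last by lia.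
  by center (p - r) (p - r - q) (2 * r - 2 + q - p).
have [j Ej] : exists j, p = 2 * j + 1.
  by case: par => // Ep; exfalso; move/eqP: pq; lia.
clear par; have [near|far] := leqP q (p + r - 1).
  clear n1 n2 n3; have [p_r'|p_r'] := ltnP p r.
    by center (p + r - 1) (p + r - 1 - q) (q - p - 1).
  by center (p - r) (p + r - 1 - q) (q - p - 1).
have p_n : p + 3 != 2 * r by lia.
by clear n1 n2 n3; center (p + r) (q - p - r) (2 * r - 2 + p - q).
Qed.

(** Again the centre is the antipode of [p] whose shortest route to [p] passes through position [q].
    The excluded p = 2r - 3 would force q = 2r - 2, where the pendants are already joined. *)
Lemma tc_good_pendant_pendant p q : branch_spec p 1 -> branch_spec q 1 ->
  t < p -> p < q -> p + 3 != 2 * r -> tc_good q 1 p 1.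
Proof.
move=> bp bq t_p p_q p_l.
have [p_r q_r] : 2 * t + 1 <= p <= 2 * r - 4 /\ p + 2 <= q <= 2 * r - 2.
  by case: bp; case: bq; lia.
have [j Ej] : exists j, p = 2 * j + 1 by case: bp => [|j|]; [lia|exists j|lia].
clear bp bq; have [near|far] := leqP q (p + r - 1).
  have [p_r'|p_r'] := ltnP p r.
    by center (p + r - 1) (p + r - q) (q - p - 2).
  by center (p - r) (p + r - q) (q - p - 2).
by center (p + r) (q + 1 - p - r) (2 * r - 3 + p - q).
Qed.

(** * The tailed cycle as a graph on n vertices *)

Variable n : nat.
Hypothesis le_n : 3 * r - 1 <= n.

(* In order: the cycle, the tail, the pendant vertices, the copies of vertex 0. *)
Definition tc_pos (i : 'I_n) : nat :=
  if i < N then i : nat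
  else if i < N + t then t
  else if i < 3 * r - 2 then 2 * (i - N) + 1
  else if i < 3 * r - 1 then 2 * r - 2 else 0.

Definition tc_ht (i : 'I_n) : nat :=
  if i < N then 0
  else if i < N + t then i - N + 1
  else if i < 3 * r - 1 then 1 else 0.

Lemma tc_branch u : 0 < tc_ht u -> branch_spec (tc_pos u) (tc_ht u).
Proof.
rewrite /tc_ht /tc_pos; do 3?case: ifP; move=> *; try lia.
- by apply: BranchTail; lia.
- case: ifP => ?; last by apply: BranchLast; lia.
  by apply: (@BranchOdd _ _ (u - N)); lia.
Qed.

Lemma tc_branch_onto p h :
  branch_spec p h -> exists u, tc_pos u = p /\ tc_ht u = h.
Proof.
have mk i : i < n -> exists u : 'I_n, u = i :> nat.
  by move=> lt_i; exists (Ordinal lt_i).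
case=> [Ep h_t|j Ep p_r Eh|Ep Eh].
- have [u Eu] := mk (N + h - 1) ltac:(lia); exists u.
  by rewrite /tc_pos /tc_ht Eu; split; do 4?case: ifP; lia.
- have [u Eu] := mk (N + j) ltac:(lia); exists u.
  by rewrite /tc_pos /tc_ht Eu; split; do 4?case: ifP; lia.
- have [u Eu] := mk (3 * r - 2) ltac:(lia); exists u.
  by rewrite /tc_pos /tc_ht Eu; split; do 4?case: ifP; lia.
Qed.

Lemma tc_cycle_onto p : p < N -> exists2 u, tc_ht u == 0 & tc_pos u = p.
Proof.
move=> lt_p; have lt_n : p < n by lia.
exists (Ordinal lt_n); rewrite /tc_ht /tc_pos /=.
  by rewrite lt_p.
by rewrite lt_p.
Qed.

Lemma tc_pos_lt u : tc_pos u < N.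
Proof. by rewrite /tc_pos; do 4?case: ifP; lia. Qed.

(** Only the copies of vertex 0 share their coordinates. *)
Lemma tc_inj u v : (0 < tc_pos u) || (0 < tc_ht u) ->
  tc_pos u = tc_pos v -> tc_ht u = tc_ht v -> u = v.
Proof.
move=> nz Ep Eh; apply: ord_inj; move: nz Ep Eh; rewrite /tc_pos /tc_ht.
by do 4?case: ifP; move=> ? ? ? ?; do 4?case: ifP; lia.
Qed.

Definition tc_near (p h q k : nat) : bool :=
  [|| (p == q) && ((h <= k.+1) && (k <= h.+1)),
      [&& h == 0, k == 0 & cyc_adj N p q] |
      [&& h == 1, k == 1, (p == 2 * r - 3) || (p == 2 * r - 2) &
          (q == 2 * r - 3) || (q == 2 * r - 2)]].

Definition tc_rel : rel 'I_n := fun u v =>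
  (u != v) && tc_near (tc_pos u) (tc_ht u) (tc_pos v) (tc_ht v).

Lemma tc_nearC p h q k : tc_near p h q k = tc_near q k p h.
Proof. by rewrite /tc_near cyc_adjC; lia. Qed.

Lemma tc_rel_sym : symmetric tc_rel.
Proof. by move=> u v; rewrite /tc_rel eq_sym tc_nearC. Qed.

Lemma tc_rel_irrefl : irreflexive tc_rel.
Proof. by move=> u; rewrite /tc_rel eqxx. Qed.

Let G := SGraph tc_rel_sym tc_rel_irrefl.

Lemma tc_reach_cycle k u v : tc_ht u = 0 -> tc_ht v = 0 -> 0 < k ->
  cyc_dist N (tc_pos u) (tc_pos v) <= k -> reach tc_rel k u v.
Proof.
move=> /eqP hu /eqP hv; apply: (reach_cyc (C := fun w => tc_ht w == 0)) => //.
- by lia.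
- by move=> w _; apply: tc_pos_lt.
- exact: tc_cycle_onto.
- move=> x y /eqP hx /eqP hy xy h; rewrite /tc_rel xy /tc_near hx hy /=.
  by case/orP: h => ->; rewrite ?orbT.
- exact: tc_rel_sym.
Qed.

Lemma tc_reach_down l v : l <= tc_ht v ->
  exists w,
    [/\ tc_pos w = tc_pos v, tc_ht w = tc_ht v - l & reach tc_rel l w v].
Proof.
elim: l => [|l IH] lv.
  by exists v; split; [|lia|exact: reach_refl].
have [|w [pw hw wv]] := IH; first lia.
have [u [pu hu]] : exists u, tc_pos u = tc_pos v /\ tc_ht u = tc_ht v - l.+1.
  have [h0|h0] := posnP (tc_ht v - l.+1).
    have [u /eqP hu pu] := tc_cycle_onto (tc_pos_lt v).
    by exists u; rewrite pu hu h0.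
  apply: tc_branch_onto; have := @tc_branch v; case; first lia.
  - by move=> Ep hr; apply: BranchTail => //; lia.
  - by move=> j Ep pr Eh; lia.
  - by move=> Ep Eh; lia.
exists u; rewrite pu hu; split=> //; rewrite -add1n; apply: reach_trans wv.
apply: reach_edge; rewrite /tc_rel /tc_near pu hu pw hw eqxx /=.
apply/andP; split; last by lia.
by apply/eqP=> E; move: hu hw; rewrite E; lia.
Qed.

Lemma tc_branch_pos v : 0 < tc_ht v -> 0 < tc_pos v.
Proof. by move/tc_branch; case=> *; lia. Qed.

(** The second hypothesis excludes two distinct copies of vertex 0, which coordinates cannot tell
    apart when [k] is 0. *)
Lemma tc_reach k u v :
  tc_close k (tc_pos u) (tc_ht u) (tc_pos v) (tc_ht v) ->
  (tc_pos u = tc_pos v -> tc_ht u = tc_ht v -> u = v) ->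
  reach tc_rel k u v.
Proof.
move=> close_uv inj_uv; have uN := tc_pos_lt u; have vN := tc_pos_lt v.
have via_cycle : tc_ht u + tc_ht v + cyc_dist N (tc_pos u) (tc_pos v) <= k ->
    reach tc_rel k u v.
  move=> uvk.
  have [a [pa ha au]] := tc_reach_down (leqnn (tc_ht u)).
  have [b [pb hb bv]] := tc_reach_down (leqnn (tc_ht v)).
  have ab : reach tc_rel (cyc_dist N (tc_pos u) (tc_pos v)) a b.
    have [d0|d_gt0] := posnP (cyc_dist N (tc_pos u) (tc_pos v)); last first.
      by apply: tc_reach_cycle => //; rewrite ?pa ?pb; lia.
    have Epos : tc_pos u = tc_pos v by move: d0; rewrite /cyc_dist; lia.
    suff -> : a = b by rewrite d0; apply: reach_refl.
    have [pu0|pu_gt0] := posnP (tc_pos u); last by apply: tc_inj; lia.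
    have hu0 : tc_ht u = 0 by have := @tc_branch_pos u; lia.
    have hv0 : tc_ht v = 0 by have := @tc_branch_pos v; lia.
    move: au bv; rewrite hu0 hv0 => /reach0 -> /reach0 ->.
    by apply: inj_uv => //; lia.
  apply: (reach_weaken uvk); rewrite addnAC; apply: reach_trans bv.
  by apply: reach_trans ab; apply: reach_sym au; apply: tc_rel_sym.
case: close_uv => [hk|[hk|[[Epos hk]|twin]]].
- by apply: via_cycle; rewrite /cyc_dist; lia.
- by apply: via_cycle; rewrite /cyc_dist; lia.
- wlog le_uv : u v {uN vN via_cycle} inj_uv Epos hk / tc_ht u <= tc_ht v.
    move=> W; case/orP: (leq_total (tc_ht u) (tc_ht v)) => le; first exact: W.
    apply: reach_sym; first exact: tc_rel_sym.
    by apply: W => // *; [apply/esym/inj_uv | lia].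
  have [w [pw hw wv]] := @tc_reach_down (tc_ht v - tc_ht u) v ltac:(lia).
  have [E|E] := eqVneq w u; first by rewrite -E; apply: reach_weaken wv; lia.
  case: (posnP (tc_ht v)) => hv0; last first.
    have := tc_branch_pos hv0 => pv; case/eqP: E; apply: tc_inj; lia.
  have -> : u = v by apply: inj_uv => //; lia.
  exact: reach_weaken (leq0n k) (reach_refl _ _).
- have [_ [_ [_ [_ [_ k_gt0]]]]] := twin; apply: reach_weaken k_gt0 _.
  apply: reach_edge; rewrite /tc_rel /tc_near; apply/andP; split; last by lia.
  by apply/eqP=> E; move: twin; rewrite E; lia.
Qed.

(** * Connectedness, radius and diameter of the tailed cycle *)

Lemma tc_connected : connected G.
Proof.
have [x _ _] := tc_cycle_onto (p := 0) ltac:(lia).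
apply: (@connected_reach G x) => u v.
have [E|uv] := eqVneq u v; first by exists 0; rewrite E; apply: reach_refl.
have [a [pa ha au]] := tc_reach_down (leqnn (tc_ht u)).
have [b [pb hb bv]] := tc_reach_down (leqnn (tc_ht v)).
exists (tc_ht u + r + tc_ht v); apply: reach_trans bv.
apply: reach_trans (reach_sym tc_rel_sym au) _.
apply: tc_reach_cycle; rewrite ?pa ?pb; try lia.
by have := tc_pos_lt u; have := tc_pos_lt v; rewrite /cyc_dist; lia.
Qed.

Lemma tc_reach_gt0 k u v : 0 < k ->
  tc_close k (tc_pos u) (tc_ht u) (tc_pos v) (tc_ht v) -> reach tc_rel k u v.
Proof.
move=> k_gt0 close_uv.
have [/andP[/eqP Ep /eqP Eh]|neq] :=
    boolP ((tc_pos u == tc_pos v) && (tc_ht u == tc_ht v)); last first.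
  by apply: tc_reach => // Ep Eh; move: neq; rewrite Ep Eh !eqxx.
have [nz|/norP[p0 h0]] := boolP ((0 < tc_pos u) || (0 < tc_ht u)).
  by apply: tc_reach => // *; apply: tc_inj.
by apply: tc_reach_cycle => //; rewrite /cyc_dist; lia.
Qed.

Lemma tc_spec u :
  tc_ht u = 0 \/ branch_spec (tc_pos u) (tc_ht u).
Proof. by case: (posnP (tc_ht u)) => [|/tc_branch]; [left|right]. Qed.

Lemma tc_rad_le : rad G <= r.
Proof.
have [c /eqP hc pc] := tc_cycle_onto (p := t) ltac:(lia).
apply: (@rad_le_reach G r c) => x; apply: tc_reach_gt0; first lia.
rewrite hc pc /tc_close; have := tc_pos_lt x.
by case: (tc_spec x) => [->|[? ?|j ? ? ?|? ?]]; lia.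
Qed.

Lemma tc_diam_le : diam G <= r + t.
Proof.
apply/diam_leP=> u v; apply/dist_le_reach/tc_reach_gt0; first lia.
have := tc_pos_lt u; have := tc_pos_lt v; rewrite /tc_close.
by case: (tc_spec u) => [->|[? ?|j ? ? ?|? ?]];
  case: (tc_spec v) => [->|[? ?|j' ? ? ?|? ?]]; lia.
Qed.

Lemma tc_dist_ge c x : tc_ht c = 0 ->
  cyc_dist N (tc_pos c) (tc_pos x) + tc_ht x <= @dist G c x.
Proof.
move=> hc; pose f (v : vertex G) := cyc_dist N (tc_pos c) (tc_pos v) + tc_ht v.
have lip u v : @adj G u v -> f v <= (f u).+1.
  case/andP=> _; rewrite /f /tc_near.
  case/or3P=> [/andP[/eqP -> h]|/and3P[hu hv h]|h].
  - by lia.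
  - have := cyc_dist_adj (tc_pos_lt c) (tc_pos_lt u) (tc_pos_lt v) h.
    by rewrite (eqP hu) (eqP hv); lia.
  - by have := tc_pos_lt c; move: h; rewrite /cyc_dist; lia.
have := @lipschitz_dist G f c x tc_connected lip.
by rewrite /f hc; rewrite [cyc_dist N (tc_pos c) (tc_pos c)]/cyc_dist; lia.
Qed.

Lemma tc_rad_ge : r <= rad G.
Proof.
apply: rad_geP tc_connected _ => c; have c_lt := tc_pos_lt c.
have [hc|hc] := posnP (tc_ht c); last first.
  have [x /eqP hx px] : exists2 x, tc_ht x == 0 & tc_pos x =
      if tc_pos c < r then tc_pos c + r - 1 else tc_pos c - r.
    by apply: tc_cycle_onto; move: c_lt; case: ifP; lia.
  exists x; rewrite (@dist_sym G c x tc_connected).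
  apply: leq_trans (tc_dist_ge _ hx); move: c_lt; rewrite px /cyc_dist.
  by case: ifP; lia.
suff [p [h [br far]]] : exists p h,
    branch_spec p h /\ r <= cyc_dist N (tc_pos c) p + h.
  have [x [px hx]] := tc_branch_onto br; exists x.
  by apply: leq_trans (tc_dist_ge _ hc); rewrite px hx.
move: c_lt; rewrite /cyc_dist; move: (tc_pos c) => p p_lt.
(* The antipodes of [p] are [i] and i + 1 modulo N. If i < 2t the tip of the tail is far; if i = 2r
   - 2 the last pendant is; otherwise the pendant at the odd one of [i] and i + 1. *)
pose i := if p < r then p + r - 1 else p - r.
have Ei : i = if p < r then p + r - 1 else p - r by [].
have := odd_double_half i; move: i Ei => i Ei Eodd.
have [lt_i|ge_i] := ltnP i (2 * t).
  exists t, t; split; first by apply: BranchTail; lia.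
  by move: Ei; case: ifP; lia.
have [last_i|lt_i] := ltnP (2 * r - 3) i.
  exists (2 * r - 2), 1; split; first by apply: BranchLast; lia.
  by move: Ei; case: ifP; lia.
exists (2 * i./2 + 1), 1; split.
  by apply: (@BranchOdd _ _ i./2) => //; move: Eodd; case: odd; lia.
by move: Ei Eodd; case: ifP; case: odd; lia.
Qed.

(** * Edges that skip a level lower the radius *)

Lemma tc_good_center (f : rel 'I_n) u v : subrel tc_rel f -> f u v ->
  tc_good (tc_pos u) (tc_ht u) (tc_pos v) (tc_ht v) ->
  exists c, forall w, reach f (r - 1) c w.
Proof.
move=> sub_f fuv [p [k [k' [p_lt k_r close_u branches]]]].
(* If [u] has the coordinates of the centre, [u] itself is taken: with k = 0 another copy of vertex
   0 would not do. *)
have [c [/eqP hc pc cu]] : exists c, [/\ tc_ht c == 0, tc_pos c = p &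
    (tc_pos c = tc_pos u -> tc_ht c = tc_ht u -> c = u)].
  case: (boolP ((tc_pos u == p) && (tc_ht u == 0))) => [/andP[/eqP pu hu]|neq].
    by exists u.
  have [c hc pc] := tc_cycle_onto p_lt; exists c; split=> // Ep Eh.
  by move: neq; rewrite -Ep -Eh pc hc eqxx.
exists c => w; have [hw|hw] := posnP (tc_ht w).
  apply: (reach_sub sub_f); apply: tc_reach_cycle => //; first lia.
  by have := tc_pos_lt c; have := tc_pos_lt w; rewrite /cyc_dist; lia.
have -> : r - 1 = k + k' + 1 by lia.
case: (branches _ _ (tc_branch hw)) => close_w.
  by apply: (reach_sub sub_f); apply: tc_reach_gt0; rewrite ?pc ?hc //; lia.
have vw : reach f k' v w.
  apply: (reach_sub sub_f); apply: tc_reach => // Ep Eh; apply: tc_inj => //.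
  by rewrite Eh hw orbT.
have cu' : reach f k c u.
  by apply: (reach_sub sub_f); apply: tc_reach => //; rewrite pc hc.
by rewrite addnAC; apply: reach_trans (reach_trans cu' (reach_edge fuv)) vw.
Qed.

(* The distance in G from the tip of the tail. *)
Definition tc_level (u : 'I_n) : nat :=
  if tc_pos u == t then t - tc_ht u
  else t + cyc_dist N t (tc_pos u) + tc_ht u.

Lemma tc_class u : tc_ht u = 0 \/ (tc_pos u = t /\ 0 < tc_ht u <= t \/
  [/\ tc_ht u = 1, branch_spec (tc_pos u) 1 & t < tc_pos u]).
Proof.
case: (tc_spec u) => [|br]; [by left|right].
case: (br) => [Ep h_t|j Ep p_r Ep' Eh|Ep Eh].
- by left.
- by right; rewrite Eh in br; split=> //; lia.
- by right; rewrite Eh in br; split=> //; lia.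
Qed.

(** Nine cases, by whether each end is on the cycle, in the tail or pendant. For two cycle vertices
    the jump in level says that their distances from [t] differ by at least two. *)
Lemma tc_jump_good u v :
  ~~ tc_near (tc_pos u) (tc_ht u) (tc_pos v) (tc_ht v) ->
  tc_level u + 2 <= tc_level v ->
  tc_good (tc_pos u) (tc_ht u) (tc_pos v) (tc_ht v) \/
  tc_good (tc_pos v) (tc_ht v) (tc_pos u) (tc_ht u).
Proof.
rewrite /tc_level; have := tc_pos_lt u; have := tc_pos_lt v.
case: (tc_class u) => [->|[[-> hu]|[-> bu up]]];
  case: (tc_class v) => [->|[[-> hv]|[-> bv vp]]] v_lt u_lt.
- move=> _; rewrite !subn0 !addn0 => jump; apply: tc_good_cycle_cycle => //.
  have d0 : cyc_dist N t t = 0 by rewrite /cyc_dist; lia.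
  by move: jump; case: eqP => [->|_]; case: eqP => [->|_]; rewrite ?d0; lia.
- move=> far _; left; apply: tc_good_cycle_tail => //.
  by move: far; rewrite /tc_near; lia.
- move=> far _; apply/or_comm; apply: tc_good_pendant_cycle => //; first lia.
  by move: far; rewrite /tc_near; lia.
- move=> far _; right; apply: tc_good_cycle_tail => //.
  by move: far; rewrite /tc_near; lia.
- move=> far _; have [uv|uv] : tc_ht u + 2 <= tc_ht v \/ tc_ht v + 2 <= tc_ht u.
    by move: far; rewrite /tc_near; lia.
  + by left; apply: tc_good_tail_tail; lia.
  + by right; apply: tc_good_tail_tail; lia.
- by move=> _ _; right; apply: tc_good_pendant_tail => //; lia.
- move=> far _; apply: tc_good_pendant_cycle => //; first lia.
  by move: far; rewrite /tc_near; lia.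
- by move=> _ _; left; apply: tc_good_pendant_tail => //; lia.
- move=> far _; have [uv|uv|uv] := ltngtP (tc_pos u) (tc_pos v).
  + right; apply: tc_good_pendant_pendant => //.
    by move: far; rewrite /tc_near; case: bv; lia.
  + left; apply: tc_good_pendant_pendant => //.
    by move: far; rewrite /tc_near; case: bu; lia.
  + by move: far; rewrite /tc_near uv eqxx.
Qed.

Lemma tc_level_near u v :
  tc_near (tc_pos u) (tc_ht u) (tc_pos v) (tc_ht v) ->
  tc_level v <= (tc_level u).+1.
Proof.
rewrite /tc_near /tc_level; have := tc_pos_lt u; have := tc_pos_lt v.
move=> v_lt u_lt /or3P[/andP[/eqP -> h]|/and3P[/eqP -> /eqP -> h]|h].
- by case: eqP; lia.
- have t_N : t < N by lia.
  have d0 : cyc_dist N t t = 0 by rewrite /cyc_dist; lia.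
  have := cyc_dist_adj t_N u_lt v_lt h.
  by case: eqP => [->|_]; case: eqP => [->|_]; rewrite ?d0; lia.
- have [/negbTE-> /negbTE->] : tc_pos v != t /\ tc_pos u != t by lia.
  by rewrite /cyc_dist; lia.
Qed.

Lemma exists_radially_maximal_diam : exists H : sgraph,
  [/\ radially_maximal H, rad H = r, diam H = r + t & graph_order H = n].
Proof.
have radG : rad G = r by apply/eqP; rewrite eqn_leq tc_rad_le tc_rad_ge.
have [f [fs [fi [ef fmax frad]]]] :=
  radially_maximal_supergraph (ltac:(lia) : 1 < r) tc_connected radG.
exists (SGraph fs fi); split=> //; last exact: card_ord.
have [fconn _ _] := fmax.
have no_center c : ~ forall w, reach f (r - 1) c w.
  by move/(@rad_le_reach (SGraph fs fi) _ c); rewrite frad; lia.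
(* An edge that jumps a level would create a vertex of eccentricity at most r - 1, so levels stay a
   valid potential in the supergraph. *)
have level_lip u v : f u v -> tc_level v <= (tc_level u).+1.
  move=> fuv.
  have [|far] := boolP (tc_near (tc_pos u) (tc_ht u) (tc_pos v) (tc_ht v)).
    exact: tc_level_near.
  rewrite leqNgt; apply/negP=> jump.
  have [||good|good] := @tc_jump_good u v => //.
  - by lia.
  - by have [c] := tc_good_center ef fuv good; apply: no_center.
  - rewrite fs in fuv.
    by have [c] := tc_good_center ef fuv good; apply: no_center.
apply/eqP; rewrite eqn_leq; apply/andP; split.
  exact: leq_trans (diam_supergraph fs fi ef tc_connected) tc_diam_le.
have [x [px hx]] := tc_branch_onto (@BranchTail t t erefl ltac:(lia)).
(* The antipodes of [t] are t + r - 1 and t + r; the odd one carries a pendant, of level t + (r - 1)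
   + 1, while the tip has level 0. *)
have [q [br Eq]] : exists q, branch_spec q 1 /\ (q + 1 = t + r \/ q = t + r).
  have := odd_double_half (t + r); case: odd => Eh.
    by exists (t + r); split; [apply: (@BranchOdd _ _ (t + r)./2); lia|right].
  exists (t + r - 1); split; last by lia.
  by apply: (@BranchOdd _ _ (t + r)./2.-1); lia.
have [y [py hy]] := tc_branch_onto br.
apply: leq_trans (@dist_diam (SGraph fs fi) x y).
have := @lipschitz_dist (SGraph fs fi) tc_level x y fconn level_lip.
rewrite /tc_level px hx py hy eqxx /cyc_dist; case: eqP; lia.
Qed.

End TailedCycle.

Theorem theorem2 (r d n : nat) (r_gt0 : 0 < r) (d_gt0 : 0 < d) (n_gt0 : 0 < n) :
  (2 <= r -> 2 * r <= n ->
     exists G : sgraph,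
       [/\ self_centered G, radially_maximal G, rad G = r & graph_order G = n])
  /\
  (r < d <= 2 * r - 2 -> 3 * r - 1 <= n ->
     exists G : sgraph,
       [/\ radially_maximal G, rad G = r, diam G = d & graph_order G = n]).
Proof.
split=> [r_gt1 le_n|r_d le_n].
  exact: exists_self_centered_radially_maximal.
have -> : d = r + (d - r) by lia.
by apply: (@exists_radially_maximal_diam r (d - r) (2 * r - 1) _ _ _ n); lia.
Qed.
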